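(* Let $G$ be a connected $3$-regular graph. If $G$ has a unique longest cycle $\mathfrak{c}$, then at least two connected components of the graph $G - E(\mathfrak{c})$ (obtained from $G$ by deleting the edges of $\mathfrak{c}$ but keeping all vertices) contain an odd number of vertices of $\mathfrak{c}$. Moreover, there exist infinitely many connected $3$-regular graphs $G$ with a unique longest cycle $\mathfrak{c}$ such that exactly two connected components of $G - E(\mathfrak{c})$ contain an odd number of vertices of $\mathfrak{c}$.
   Context: Graphs are finite and simple. *)

(* Defs.v *)
From mathcomp Require Import all_boot.
Set Implicit Arguments.
Unset Strict Implicit.
Unset Printing Implicit Defensive.

Record sgraph := SGraph {
  vertex :> finType;
  adj : rel vertex;
  adj_sym : symmetric adj;
  adj_irr : irreflexive adj }.

Definition graph_iso (G H : sgraph) : Prop :=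
  exists f : G -> H, bijective f /\ forall x y, adj (f x) (f y) = adj x y.

Definition connected (G : sgraph) : Prop :=
  0 < #|G| /\ forall x y : G, connect (@adj G) x y.

Definition regular (k : nat) (G : sgraph) : Prop :=
  forall x : G, #|[set y | adj x y]| = k.

Definition components (G : sgraph) : {set {set G}} :=
  equivalence_partition (connect (@adj G)) [set: G].

Section DeleteEdges.
Variables (G : sgraph) (A : {set {set G}}).

(* An edge is encoded as the unordered pair [set x; y] of its endpoints. *)
Definition del_adj : rel G := [rel x y | adj x y && ([set x; y] \notin A)].

Lemma del_adj_sym : symmetric del_adj.
Proof. by move=> x y; rewrite /del_adj /= adj_sym setUC. Qed.

Lemma del_adj_irr : irreflexive del_adj.
Proof. by move=> x; rewrite /del_adj /= adj_irr. Qed.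

Definition del_edges : sgraph := SGraph del_adj_sym del_adj_irr.
End DeleteEdges.

Section Cycles.
Variable G : sgraph.

(* A cycle is given by a cyclic enumeration of its vertices; ucycle alone would
   also accept the empty sequence and a single edge traversed back and forth. *)
Definition is_cycle (c : seq G) : Prop := 2 < size c /\ ucycle (@adj G) c.

Definition cycle_edges (c : seq G) : {set {set G}} :=
  [set [set x; next c x] | x in c].

Definition longest_cycle (c : seq G) : Prop :=
  is_cycle c /\ forall d : seq G, is_cycle d -> size d <= size c.

(* Two enumerations describe the same cycle, as a subgraph, exactly when they
   have the same edge set (they then differ by rotation and reversal). *)
Definition unique_longest_cycle (c : seq G) : Prop :=
  longest_cycle c /\
  forall d : seq G, longest_cycle d -> cycle_edges d = cycle_edges c.

Definition odd_components (c : seq G) : {set {set G}} :=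
  [set K in components (del_edges (cycle_edges c)) |
    odd #|[set x in K | x \in c]|].
End Cycles.

(* Main.v *)
Require Import Defs.
From mathcomp Require Import all_boot.
Set Implicit Arguments.
Unset Strict Implicit.
Unset Printing Implicit Defensive.

(** Lower bound. Suppose at most one component of G - E(c) meets c in an odd
    number of vertices, and choose v0 on c, inside that component if there is
    one. Adding modulo 2 suitable paths of G - E(c) gives a subgraph J in which
    a vertex other than v0 has odd degree exactly when it lies on c. In c + J,
    a version of Thomason's lollipop argument shows that the number of cycles
    which contain V(c) and a given edge of c at v0 is even: the paths that
    start with this edge and cover V(c) are linked by rotation at, extension
    of, and retraction of their free end, and the parity of the degrees makes
    the number of such moves even except for closures into a cycle. So c + J
    contains a second cycle through V(c), against uniqueness.

    Examples. Join by bridges, at its two vertices of degree 2, a hexagon with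
    two chords to cubic pieces all of whose cycles have length at most 5. A
    cycle cannot use a bridge, so the hexagon is the unique longest cycle; each
    chord puts two vertices of the hexagon in one component, so only the
    components of the two remaining vertices can be odd. *)

(** * Parity of finite counts *)

Lemma even_size_involution (T : eqType) (f : T -> T) (s : seq T) :
    uniq s -> {in s, forall x, [/\ f x \in s, f (f x) = x & f x != x]} ->
  ~~ odd (size s).
Proof.
have [n] := ubnP (size s); elim: n s => // n IHn [|x s] //= /ltnSE-le_s_n.
case/andP=> xs us fP; have [] := fP x (mem_head _ _).
rewrite inE => /orP[->//|fxs] ffx fxx.
have us' : uniq (rem (f x) s) by rewrite rem_uniq.
have sz : size s = (size (rem (f x) s)).+1.
  by rewrite size_rem //; case: (s) fxs.
rewrite sz /= negbK; apply: IHn => //; first by rewrite -ltnS -sz ltnS ltnW.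
move=> y; rewrite mem_rem_uniq // inE => /andP[/= yfx ys].
have [|fys ffy fyy] := fP y; first by rewrite inE ys orbT.
split=> //; rewrite mem_rem_uniq // inE /=; apply/andP; split.
  by apply: contraNneq xs => fyfx; rewrite -ffx -fyfx ffy.
by move: fys; rewrite inE => /predU1P[fyx|//]; rewrite -fyx ffy eqxx in yfx.
Qed.

Lemma odd_card_set (T : finType) (P : pred T) :
  odd #|[set y | P y]| = \big[addb/false]_y P y.
Proof.
rewrite -sum1dep_card big_mkcond (big_morph odd oddD (erefl _)).
by apply: eq_bigr => y _; case: (P y).
Qed.

Lemma odd_card_addb (T : finType) (P Q : pred T) :
  odd #|[set y | P y (+) Q y]| = odd #|[set y | P y]| (+) odd #|[set y | Q y]|.
Proof. by rewrite !odd_card_set big_split. Qed.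

(** * Subgraphs with prescribed degree parities *)

Section ParitySubgraphs.
Variables (V : finType) (e : rel V).
Hypotheses (e_sym : symmetric e) (e_irr : irreflexive e).

(** The edges of a walk from [x] to [y] are added modulo 2, so the walk may repeat vertices; each
    new edge flips the parity at its two ends, distinct by irreflexivity. *)
Lemma path_parity_subgraph x y : connect e x y ->
  exists J : rel V, [/\ symmetric J, subrel J e &
    forall z, odd #|[set w | J z w]| = (z == x) (+) (z == y)].
Proof.
case/connectP=> p; elim: p x => [|w p IHp] x /= => [_ ->|/andP[exw ewp] yE].
  exists (fun _ _ => false); split=> // z.
  by rewrite addbb odd_card_set big1.
have [J [Jsym Je Jodd]] := IHp w ewp yE.
pose I := [rel a b | (a == x) && (b == w) || (a == w) && (b == x)].
have xw : x != w by apply: contraTneq exw => ->; rewrite e_irr.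
exists (fun a b => I a b (+) J a b); split=> [a b|a b|z].
- by rewrite Jsym /= orbC ![(b == _) && _]andbC.
- case Jab: (J a b); first by rewrite (Je _ _ Jab).
  by rewrite addbF => /orP[]/andP[/eqP-> /eqP->] //; rewrite e_sym.
- rewrite odd_card_addb Jodd addbA; congr (_ (+) _).
  rewrite odd_card_set /=.
  have [->|zx] := eqVneq z x.
    by rewrite (negPf xw) (bigD1 w) //= eqxx big1 // => b /negPf->.
  have [_|_] := eqVneq z w; last by rewrite big1.
  by rewrite (bigD1 x) //= eqxx big1 // => b /negPf->.
Qed.

(** Sum modulo 2 of one path from [x] to [rho x] for every [x] in [s]: a vertex is counted once for
    each path end it carries. *)
Lemma parity_subgraph (rho : V -> V) (s : seq V) :
    (forall x, connect e x (rho x)) ->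
  exists J : rel V, [/\ symmetric J, subrel J e &
    forall z, odd #|[set w | J z w]| =
      odd (count_mem z s) (+) odd (count (fun x => rho x == z) s)].
Proof.
move=> rhoP; elim: s => [|x s [J [Jsym Je Jodd]]].
  by exists (fun _ _ => false); split=> // z; rewrite odd_card_set big1.
have [I [Isym Ie Iodd]] := path_parity_subgraph (rhoP x).
exists (fun a b => I a b (+) J a b); split=> [a b|a b|z].
- by rewrite Isym Jsym.
- by case Jab: (J a b); [rewrite (Je _ _ Jab) | rewrite addbF => /Ie].
- rewrite odd_card_addb Jodd Iodd /= !oddD !oddb.
  by rewrite (eq_sym z x) (eq_sym z (rho x)) addbACA.
Qed.
End ParitySubgraphs.

(** * Lollipop paths and their moves *)

Lemma suffix2_cat (T : eqType) (a b z : T) (p s : seq T) : z != b ->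
  suffix [:: a; b] (p ++ z :: s) = suffix [:: a; b] (z :: s).
Proof.
move=> /negPf zb; rewrite /suffix rev_cat [rev (z :: s)]rev_cons.
by case: (rev s) => [|x [|x' t]] //=; rewrite ?prefix0s // eq_sym zb.
Qed.

Section Lollipop.
Variables (V : finType) (e : rel V) (X : {set V}) (v0 v1 : V).
Hypotheses (e_sym : symmetric e) (e_irr : irreflexive e).
Hypothesis odd_degree : forall x, x != v0 -> odd #|[set y | e x y]| = (x \in X).
Hypothesis X_gt2 : 2 < #|X|.

(* Paths are listed from their free end, so that they all stop with v1, v0. *)
Definition lollipop_path (q : seq V) :=
  [&& uniq q, sorted e q, suffix [:: v1; v0] q & X \subset q].

(** The last conjunct allows the move along the last edge only when the free end lies outside [X],
    since the shortened path must still cover [X]. *)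
Definition lollipop_flag (f : seq V * V) :=
  [&& lollipop_path f.1, e (head v0 f.1) f.2 &
      (f.2 == nth v0 f.1 1) ==> (head v0 f.1 \notin X)].

(* A flag (q, z) is a move along the edge from the free end of q to z: it
   retracts q if this is its last edge, rotates q if z is another vertex of q,
   and extends q otherwise. *)
Definition lollipop_step (f : seq V * V) : seq V * V :=
  let: (q, z) := f in
  if z == nth v0 q 1 then (behead q, head v0 q)
  else if z \in q then
    (rev (take (index z q) q) ++ drop (index z q) q, z)
  else (z :: q, head v0 q).

(** Covering [X] forces at least three vertices, and [v0] occurs only at the end. *)
Lemma lollipop_path_head q : lollipop_path q ->
  exists y z s, [/\ q = [:: y, z & s], y != v0, z != v0 & s != [::]].
Proof.
case/and4P=> uq _ sq Xq.
have: 2 < size q.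
  apply: leq_trans X_gt2 _; rewrite -(card_uniqP uq).
  exact/subset_leq_card.
case: q uq sq {Xq} => [|y [|z [|w s]]] // uq sq _.
exists y, z, (w :: s).
have [yv0 zv0] : y != v0 /\ z != v0; last by [].
case/suffixP: sq uq => -[|y' [|z' r]] //.
  by case=> -> -> -> ->; rewrite /= !inE !negb_or => /and3P[/andP[_ ->] ->].
case=> -> -> -> /=; rewrite !inE !mem_cat !inE !negb_or.
by case/and3P=> /and4P[_ _ _ ->] /and3P[_ _ ->].
Qed.

(** Retraction and extension undo each other, and a rotation at [z] is undone by the rotation of the
    new path at [z]. Since [z] is not [v0], the final [v1], [v0] stays in place. *)
Lemma lollipop_stepP f : lollipop_flag f -> f.2 != v0 ->
  let g := lollipop_step f in
  [/\ lollipop_flag g, g.2 != v0, lollipop_step g = f & g != f].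
Proof.
case: f => q z /= /and3P[/= Pq eyz zX] zv0.
have [y [w [s [qE yv0 wv0 s0]]]] := lollipop_path_head Pq.
have /and4P[uq pq sq Xq] := Pq.
have hq : head v0 q = y by rewrite qE.
have nq : nth v0 q 1 = w by rewrite qE.
rewrite hq nq in eyz zX *.
have wy : (y == w) = false by move: uq; rewrite qE /= inE; case: eqP.
have zy : (z == y) = false by apply: contraTF eyz => /eqP->; rewrite e_irr.
case: eqVneq zX => [zw /= yX|zw _] /=.
  subst z; rewrite qE in uq pq sq Xq *; rewrite /=.
  have ys : y \notin w :: s by case/andP: uq.
  have yw1 : (y == nth v0 s 0) = false.
    case: (s) ys s0 => //= a s'; rewrite !inE.
    by rewrite !negb_or => /and3P[_ /negPf].
  split=> //=; last 2 first.
  - by rewrite yw1 (negPf ys).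
  - by rewrite xpair_eqE wy andbF.
  apply/and3P; split; rewrite /= ?yw1 //; last by rewrite e_sym.
  apply/and4P; split=> //; [by case/andP: uq | by case/andP: pq | | ].
    by move: sq; rewrite (@suffix2_cat _ _ _ _ [:: y]).
  apply/subsetP => x xX; have := subsetP Xq x xX; rewrite inE.
  by case/predU1P => // xy; rewrite -xy xX in yX.
have [zq|zq] := boolP (z \in q).
  case/splitPr: zq Pq uq pq sq Xq qE {hq nq} => p1 A Pq uq pq sq Xq qE.
  have zp1 : z \notin p1.
    by move: uq; rewrite cat_uniq /= negb_or => /and3P[_ /andP[]].
  have idx (p : seq V) : z \notin p -> index z (p ++ z :: A) = size p.
    by move=> zp; rewrite index_cat (negPf zp) /= eqxx addn0.
  have [p p1E] : exists p, p1 = y :: p.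
    by case: (p1) qE => [[]|? p [->]]; [move/eqP; rewrite zy | exists p].
  (* As [z] is not the second vertex of [q], at least two vertices precede it, so the reversal
     changes the free end from [y] to [x]. *)
  have [p' [x pE]] : exists p' x, p = rcons p' x.
    case/lastP: p p1E => [p1E|p' x _]; last by exists p', x.
    by move: qE; rewrite p1E => -[/eqP]; rewrite (negPf zw).
  rewrite idx // take_size_cat // drop_size_cat //.
  have rE : rev p1 = x :: rcons (rev p') y by rewrite p1E pE rev_cons rev_rcons.
  (* Hence the step applied to the new flag is again a rotation, not a retraction. *)
  have nzr : z != nth v0 (rev p1 ++ z :: A) 1.
    rewrite rE; case Ep: (rev p') => [|a t] /=; first by rewrite zy.
    apply: contraNneq zp1 => ->; rewrite -mem_rev rE Ep.
    by rewrite !inE eqxx orbT.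
  have yx : y != x.
    move: uq; rewrite cat_uniq p1E pE /= mem_rcons inE negb_or.
    by case/andP=> /andP[/andP[]].
  split=> //=; last 2 first.
  - rewrite (negPf nzr) mem_cat mem_head orbT idx ?mem_rev //.
    by rewrite take_size_cat // drop_size_cat // revK.
  - rewrite xpair_eqE eqxx andbT rE p1E /= eqseq_cons eq_sym.
    by rewrite (negPf yx).
  apply/and3P; split; rewrite /= ?(negPf nzr) //; last first.
    move: pq; rewrite rE p1E pE /= cat_path last_rcons /=.
    by case/andP=> _ /andP[].
  apply/and4P; split.
  - rewrite (@perm_uniq _ _ (p1 ++ z :: A)) //.
    by rewrite perm_cat2r perm_rev.
  - have er : sorted e (rev p1).
      rewrite rev_sorted; have /cat_sorted2[sp1 _] := pq.
      by apply: sub_sorted sp1 => a b; rewrite e_sym.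
    move: er pq; rewrite rE p1E pE /= !cat_path !last_rcons /= => ->.
    by rewrite eyz => /and3P[].
  - by move: sq; rewrite !suffix2_cat.
  - by apply: subset_trans Xq _; apply/subsetP=> t; rewrite !mem_cat mem_rev.
have zq0 : z :: q != q.
  by apply/eqP=> /(congr1 size)/= /eqP; rewrite eqn_leq ltnn.
split=> //=; last 2 first.
- by rewrite nth0 hq eqxx.
- by rewrite xpair_eqE (negPf zq0).
apply/and3P; split=> //=; first apply/and4P; first split=> //.
- by rewrite /= zq.
- by rewrite qE /= e_sym eyz; move: pq; rewrite qE.
- by move: sq; rewrite qE (@suffix2_cat _ _ _ _ [:: z]).
- by apply: subset_trans Xq _; apply/subsetP=> t; rewrite inE orbC => ->.
- by rewrite e_sym.
- by apply/implyP=> _; apply: contraNN zq => /(subsetP Xq).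
Qed.

(** A duplicate-free sequence has length at most [#|V|], so a finite list contains all of them and
    paths can be counted. *)
Definition uniq_seqs : seq (seq V) :=
  [seq q <- [seq tval t | k <- iota 0 #|V|.+1, t <- enum {: k.-tuple V}] | uniq q].

Lemma mem_uniq_seqs q : uniq q -> q \in uniq_seqs.
Proof.
move=> uq; rewrite mem_filter uq andTb; apply/flatten_mapP; exists (size q).
  by rewrite mem_iota ltnS -(card_uniqP uq) max_card.
by apply/mapP; exists (in_tuple q); rewrite ?mem_enum.
Qed.

(** Each path has an even number of flags, so their total is even. The flags not aimed at [v0] are
    paired by [lollipop_step]. Hence those aimed at [v0], which close a path into a cycle, are even
    in number, and [(q0, v0)] is not the only one. *)
Lemma second_lollipop_cycle q0 :
    lollipop_path q0 -> e (head v0 q0) v0 ->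
  exists q, [/\ lollipop_path q, e (head v0 q) v0 & q != q0].
Proof.
move=> Pq0 eq0.
pose N := undup [seq q <- uniq_seqs | lollipop_path q].
have memN q : (q \in N) = lollipop_path q.
  rewrite mem_undup mem_filter; case: (boolP (lollipop_path q)) => //= /and4P[uq _ _ _].
  exact: mem_uniq_seqs.
pose FL := [seq f <- [seq (q, z) | q <- N, z <- enum V] | lollipop_flag f].
have uFL : uniq FL.
  rewrite filter_uniq // allpairs_uniq ?undup_uniq ?enum_uniq //.
  by move=> [a b] [a' b'].
have memFL f : (f \in FL) = lollipop_flag f.
  rewrite mem_filter; case: (boolP (lollipop_flag f)) => //= /and3P[Pf _ _].
  by case: f Pf => q z /= Pq; rewrite allpairs_f ?memN ?mem_enum.
have evenFL : ~~ odd (size FL).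
  rewrite size_filter -sum1_count big_mkcond big_allpairs /=.
  rewrite (big_morph odd oddD (erefl _)) big1_seq // => q /andP[_]; rewrite memN => Pq.
  have [y [w [s [qE yv0 wv0 s0]]]] := lollipop_path_head Pq.
  rewrite big_enum -big_mkcond /= sum1dep_card.
  (* The flags of [q] are the edges at its free end [y], without the path edge to [w] if [y] is in
     [X]; their number is even because the degree of [y] is odd exactly in that case. *)
  rewrite (_ : #|_| = #|[set z | e y z (+) (z == w) && (y \in X)]|); last first.
    apply: eq_card => z; rewrite !inE /lollipop_flag Pq qE /=.
    case: (eqVneq z w) => [->|_] /=; last by rewrite andbT addbF.
    move: Pq; rewrite qE => /and4P[_ /= /andP[-> _] _ _].
    by case: (y \in X).
  rewrite odd_card_addb odd_degree // odd_card_set (bigD1 w) //= eqxx.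
  rewrite big1 ?addbF ?addbb // => z /negPf->; exact: andFb.
have evenFL0 : ~~ odd (count (fun f => f.2 != v0) FL).
  rewrite -size_filter; apply: (@even_size_involution _ lollipop_step).
    exact: filter_uniq.
  move=> f; rewrite mem_filter memFL => /andP[f2 Ff].
  by have [Fg g2 gg gf] := lollipop_stepP Ff f2; rewrite mem_filter memFL Fg g2.
have evenC : ~~ odd (count (fun f => f.2 == v0) FL).
  move: evenFL; rewrite -(count_predC (fun f => f.2 == v0)) oddD.
  by rewrite (negPf evenFL0) addbF.
pose C := [seq f <- FL | f.2 == v0].
have q0C : (q0, v0) \in C.
  rewrite mem_filter memFL eqxx andTb; apply/and3P; split=> //=.
  have [y [w [s [-> _ wv0 _]]]] := lollipop_path_head Pq0.
  by rewrite /= eq_sym (negPf wv0).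
have [f fC f0] : exists2 f, f \in C & f != (q0, v0).
  have uC : uniq C by rewrite filter_uniq.
  rewrite -size_filter -/C in evenC.
  case: C q0C uC evenC => [|f [|f' C]] // fC /= /andP[ff' _] _.
  have [fE|ne_f] := eqVneq f (q0, v0); last by exists f; rewrite ?mem_head.
  exists f'; first by rewrite !inE eqxx orbT.
  by apply: contraNneq ff' => ->; rewrite fE mem_head.
case: f fC f0 => q z; rewrite mem_filter memFL => /andP[/= /eqP-> /and3P[/= Pq eq _]].
by rewrite xpair_eqE eqxx andbT => q_q0; exists q.
Qed.
End Lollipop.

(** * Edge sets of cycles and their enumerations *)

Lemma set2_eqP (T : finType) (x y u v : T) :
  reflect (x = u /\ y = v \/ x = v /\ y = u) ([set x; y] == [set u; v]).
Proof.
apply: (iffP eqP) => [/setP E|[[-> ->] //|[-> ->]]]; last by rewrite setUC.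
move: (E x) (E y) (E u) (E v); rewrite !inE !eqxx ?orbT /=.
move=> /esym/orP[]/eqP-> /esym/orP[]/eqP->; rewrite ?eqxx ?orbT ?orbb; auto.
- by move=> _ /eqP->; left.
- by move=> /eqP-> _; left.
Qed.

Lemma in_cycle_edges (G : sgraph) (c : seq G) x y :
  ([set x; y] \in cycle_edges c) =
  (x \in c) && (y == next c x) || (y \in c) && (x == next c y).
Proof.
apply/imsetP/orP => [[u uc /eqP/set2_eqP[][-> ->]]|].
- by left; rewrite uc eqxx.
- by right; rewrite uc eqxx.
by case=> /andP[? /eqP->]; [exists x | exists y => //; rewrite setUC].
Qed.

Lemma cycle_edges_rot (G : sgraph) (c : seq G) n :
  uniq c -> cycle_edges (rot n c) = cycle_edges c.
Proof.
move=> uc; apply/setP=> A; apply/imsetP/imsetP => -[x].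
  by rewrite mem_rot next_rot // => xc ->; exists x.
by move=> xc ->; exists x; rewrite ?mem_rot ?next_rot.
Qed.

Lemma next_next_neq (T : eqType) (c : seq T) x :
  uniq c -> 2 < size c -> x \in c -> next c (next c x) != x.
Proof.
move=> uc sc xc; have [i s E] := rot_to xc.
rewrite -!(next_rot i uc) E; have: uniq (x :: s) by rewrite -E rot_uniq.
have: 2 < size (x :: s) by rewrite -E size_rot.
case: s {E} => [|a [|b t]] //= _; rewrite !inE !negb_or eqxx.
by case/and3P=> /and3P[xa xb _] _ _; rewrite ?(eq_sym a x) (negPf xa) eqxx eq_sym.
Qed.

(** A vertex on [c] meets exactly the edges to its successor and its predecessor, which differ
    because [c] has more than two vertices; any other vertex meets none. *)
Lemma cycle_edges_degree_even (G : sgraph) (c : seq G) x :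
  uniq c -> 2 < size c -> ~~ odd #|[set y | [set x; y] \in cycle_edges c]|.
Proof.
move=> uc sc; have [xc|xc] := boolP (x \in c).
  have -> : [set y | [set x; y] \in cycle_edges c] = [set next c x; prev c x].
    apply/setP=> y; rewrite !inE in_cycle_edges xc /=; congr (_ || _).
    apply/andP/eqP => [[yc /eqP->]|->]; first by rewrite prev_next.
    by rewrite mem_prev next_prev.
  rewrite cards2; case: eqP => // E.
  by have := next_next_neq uc sc xc; rewrite E next_prev ?eqxx.
rewrite (_ : [set y | _] = set0) ?cards0 //; apply/setP=> y.
rewrite !inE in_cycle_edges (negPf xc) /=; apply/andP=> -[yc /eqP xE].
by rewrite xE mem_next yc in xc.
Qed.

Lemma fpath_next_rcons (T : eqType) (s : seq T) x :
  uniq (rcons s x) -> fpath (next (rcons s x)) x (rcons s x).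
Proof.
move/cycle_next; rewrite -(rot_cycle (size s)).
by rewrite -{2}cats1 rot_size_cat.
Qed.

(** The common ending [v1], [v0] fixes both the starting point and the direction, so following the
    edges from [v0] yields the same list. *)
Lemma ucycle_eq_edges (G : sgraph) (c d : seq G) v0 v1 :
    uniq c -> uniq d -> 2 < size c -> size d = size c ->
    suffix [:: v1; v0] c -> suffix [:: v1; v0] d ->
  cycle_edges d = cycle_edges c -> d = c.
Proof.
move=> uc ud sc sdc vc vd E.
have nextP (b : seq G) : uniq b -> suffix [:: v1; v0] b ->
   [/\ v0 \in b, prev b v0 = v1 & fpath (next b) v0 b].
  move=> ub /suffixP[r bE].
  have bE' : b = rcons (rcons r v1) v0 by rewrite bE -!cats1 -catA.
  have v0b : v0 \in b by rewrite bE' mem_rcons mem_head.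
  split=> //; last by rewrite bE'; apply: fpath_next_rcons; rewrite -bE'.
  rewrite -[v1](prev_next ub); congr prev.
  rewrite -(next_rot (size r)) // bE rot_size_cat /=.
  by rewrite eqxx.
have [v0c pc fc] := nextP c uc vc; have [v0d pd fd] := nextP d ud vd.
have step x : x \in c -> x \in d -> prev d x = prev c x ->
  [/\ next c x \in c, next c x \in d, next d x = next c x &
      prev d (next c x) = prev c (next c x)].
  move=> xc xd pE.
  have nE : next d x = next c x.
    have : [set x; next d x] \in cycle_edges c.
      by rewrite -E in_cycle_edges xd eqxx.
    (* If [c] ran through this edge backwards, [next d x] would be [prev c x], that is [prev d x],
       and [d] would return to [x] after two steps. *)
    rewrite in_cycle_edges xc /= => /orP[/eqP//|/andP[_ /eqP xE]].
    have sd : 2 < size d by rewrite sdc.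
    have := congr1 (prev c) xE; rewrite prev_next // -pE => ndE.
    by case/eqP: (next_next_neq ud sd xd); rewrite -ndE next_prev.
  split; rewrite ?mem_next // -?nE ?mem_next //.
  by rewrite prev_next // nE prev_next.
have iterE k : iter k (next d) v0 = iter k (next c) v0.
  suff [_ _ [-> _]] : [/\ iter k (next c) v0 \in c, iter k (next c) v0 \in d &
         iter k (next d) v0 = iter k (next c) v0 /\
         prev d (iter k (next c) v0) = prev c (iter k (next c) v0)] by [].
  elim: k => [|k [kc kd [kE kp]]] /=; first by rewrite pc pd.
  by rewrite kE; have [? ? -> ?] := step _ kc kd kp.
case/fpathP: fc => n cE; case/fpathP: fd => m dE.
have mn : m = n by move: sdc; rewrite cE dE !size_traject.
rewrite cE dE mn; apply: (@eq_from_nth _ v0); rewrite ?size_traject // => k kn.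
have nthE f : nth v0 (traject f (f v0) n) k = iter k.+1 f v0.
  by rewrite (set_nth_default (f v0)) ?size_traject // nth_traject // iterSr.
by rewrite !nthE iterE.
Qed.

Lemma cycle_suffix2 (T : eqType) (e : rel T) v0 v1 (q : seq T) :
    symmetric e -> suffix [:: v1; v0] q ->
  cycle e q = sorted e q && e (head v0 q) v0.
Proof.
move=> e_sym /suffixP[[|a t] ->] /=; first by rewrite (e_sym v0) !andbT.
by rewrite rcons_path last_cat /= e_sym.
Qed.

(** * Lower bound on the number of odd components *)

Theorem two_odd_components (G : sgraph) (c : seq G) :
  unique_longest_cycle c -> 2 <= #|odd_components c|.
Proof.
move=> [[[sc ucc] maxc] uniqc]; rewrite leqNgt; apply/negP; rewrite ltnS => few.
have /andP[cc uc] := ucc.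
have [v0 v0c v0P] : exists2 v0, v0 \in c &
    forall K, K \in odd_components c -> v0 \in K.
  have [E|[K KO]] := set_0Vmem (odd_components c).
    case: (c) sc E => // v0 s _ E; exists v0; first exact: mem_head.
    by move=> K; rewrite E inE.
  have: [set x in K | x \in c] != set0.
    apply: contraTneq KO => E; rewrite inE E cards0 andbF //.
  case/set0Pn=> v0; rewrite inE => /andP[v0K v0c].
  by exists v0 => // K' K'O; rewrite ((card_le1_eqP few) _ _ KO K'O).
have [i s rotE] := rot_to v0c.
case/lastP: s rotE => [/(congr1 size)|s v1 rotE].
  by rewrite size_rot => E; rewrite E in sc.
(* After [rot i] the list is [v0 :: rcons s v1]; moving [v0] to the end makes it stop with [v1],
   [v0]. *)
pose q0 := rot 1 (rot i c).
have q0E : q0 = s ++ [:: v1; v0].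
  by rewrite /q0 rotE /rot /= drop0 take0 -cats1 -catA.
have uq0 : uniq q0 by rewrite !rot_uniq.
have memq0 : q0 =i c by move=> x; rewrite !mem_rot.
have edgesq0 : cycle_edges q0 = cycle_edges c by rewrite !cycle_edges_rot ?rot_uniq.
pose H := del_edges (cycle_edges c).
pose e0 := @adj H.
have e0_sym : symmetric e0 := @adj_sym H.
have e0_irr : irreflexive e0 := @adj_irr H.
have c0_sym : connect_sym e0 by apply: sym_connect_sym.
(* Every vertex is sent to one representative of its component, chosen as [v0] in the component of
   [v0]. A representative other than [v0] is hit by the vertices of [c] in a component that is not
   odd, hence an even number of times. *)
pose rho x := if connect e0 x v0 then v0 else root e0 x.
have rhoP x : connect e0 x (rho x).
  by rewrite /rho; case: ifP => // _; apply: connect_root.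
have [J [Jsym Je Jodd]] := parity_subgraph e0_sym e0_irr c rhoP.
have rho_even z : z != v0 -> ~~ odd (count (fun x => rho x == z) c).
  move=> zv0; have [czv0|czv0] := boolP (connect e0 z v0).
    rewrite (eq_count (a2 := pred0)) ?count_pred0 // => x /=.
    apply/negbTE; apply: contraNneq zv0 => rhox.
    by move: (rhoP x); rewrite -rhox => xz; rewrite /rho (connect_trans xz) ?rhox.
  have [rz|rz] := boolP (root e0 z == z); last first.
    rewrite (eq_count (a2 := pred0)) ?count_pred0 // => x /=.
    apply/negbTE; apply: contra rz; rewrite /rho; case: ifP => [_ /eqP zE|_ /eqP<-].
      by rewrite zE connect0 in czv0.
    by rewrite root_root.
  pose K := [set y in [set: G] | connect e0 z y].
  have Kcomp : K \in components H by apply/imsetP; exists z; rewrite ?inE.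
  have KO : K \notin odd_components c.
    by apply: contra czv0 => /v0P; rewrite !inE.
  move: KO; rewrite inE Kcomp andTb; congr (~~ odd _).
  rewrite -size_filter -(card_uniqP (filter_uniq _ uc)).
  apply: eq_card => x; rewrite mem_filter !inE /=; congr (_ && _).
  rewrite /rho; case: ifP => [cx|_].
    rewrite [v0 == z]eq_sym (negPf zv0); apply/negbTE.
    by apply: contra czv0 => zx; apply: connect_trans zx cx.
  by rewrite -{2}(eqP rz) eq_sym root_connect.
pose e := [rel x y | ([set x; y] \in cycle_edges c) || J x y].
have e_sym : symmetric e by move=> x y; rewrite /= setUC Jsym.
have cedge_adj x y : [set x; y] \in cycle_edges c -> adj x y.
  rewrite in_cycle_edges => /orP[]/andP[xc /eqP->]; last rewrite adj_sym.
    exact: next_cycle cc xc.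
  exact: next_cycle cc xc.
have e_adj : subrel e (@adj G).
  by move=> x y /orP[/cedge_adj//|/Je /andP[]].
have e_irr : irreflexive e.
  by move=> x; apply/negbTE/negP => /e_adj; rewrite adj_irr.
have e_odd x : x != v0 -> odd #|[set y | e x y]| = (x \in [set x in c]).
  move=> xv0.
  (* Since [J] avoids the edges of [c], the union is also a sum modulo 2 and degree parities add. *)
  have -> : [set y | e x y] =
            [set y | ([set x; y] \in cycle_edges c) (+) J x y].
    apply/setP=> y; rewrite !inE /=; case Jxy: (J x y); last by rewrite orbF addbF.
    by have /andP[_ /negPf->] := Je _ _ Jxy.
  rewrite odd_card_addb (negPf (cycle_edges_degree_even _ uc sc)) Jodd.
  by rewrite (negPf (rho_even x xv0)) addbF count_uniq_mem // oddb inE.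
have X_gt2 : 2 < #|[set x in c]| by rewrite cardsE (card_uniqP uc).
have cyc_e : cycle e q0.
  rewrite !rot_cycle; apply: (sub_in_cycle (P := [in c])) (cycle_next uc); last exact/allP.
  by move=> x y xc _ /eqP<-; rewrite /= in_cycle_edges xc eqxx.
have sq0 : suffix [:: v1; v0] q0 by rewrite q0E suffix_suffix.
have q0P : lollipop_path e [set x in c] v0 v1 q0.
  apply/and4P; split=> //; last first.
    by apply/subsetP=> x; rewrite inE memq0.
  by case: (q0) cyc_e => //= a t; rewrite rcons_path => /andP[].
have eq0 : e (head v0 q0) v0.
  by move: cyc_e; rewrite (cycle_suffix2 e_sym sq0) => /andP[].
have [q [qP eq qq0]] := second_lollipop_cycle e_sym e_irr e_odd X_gt2 q0P eq0.
have /and4P[uq pq sq Xq] := qP.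
(* Covering [c], the cycle [q] is also a longest one, so by uniqueness it has the edges of [c];
   ending in [v1], [v0] as [q0] does, it equals [q0]. *)
have szq : size c <= size q.
  rewrite -(card_uniqP uc) -(card_uniqP uq); apply/subset_leq_card/subsetP => x xc.
  by apply: (subsetP Xq); rewrite inE.
have cq : is_cycle q.
  split; first exact: leq_trans sc szq.
  rewrite /ucycle uq andbT; apply: sub_cycle e_adj _ _.
  by rewrite (cycle_suffix2 e_sym sq) pq.
have szE : size q = size c by apply/eqP; rewrite eqn_leq szq maxc.
have lq : longest_cycle q by split=> // d /maxc; rewrite szE.
case/eqP: qq0; apply: ucycle_eq_edges sq0 sq _ => //.
- by rewrite !size_rot.
- by rewrite !size_rot.
- by rewrite edgesq0 uniqc.
Qed.

(** * Cycles in graphs joined by a bridge *)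

Lemma next_closed_all (T : eqType) (c : seq T) (P : pred T) x :
    uniq c -> {in c, forall y, P y -> P (next c y)} -> x \in c -> P x ->
  all P c.
Proof.
move=> uc Pnext xc Px; have [i s E] := rot_to xc.
pose e := [rel a b | P a ==> P b].
have: cycle e c.
  apply: (sub_in_cycle (P := [in c])) (cycle_next uc); last exact/allP.
  by move=> a b ac _ /eqP<-; apply/implyP/Pnext.
rewrite -(rot_cycle i) E /= rcons_path => /andP[pxs _].
have e_tr : transitive e by move=> b a d /=; case: (P a) (P b) => [] [].
rewrite -(eq_all_r (mem_rot i c)) E /= Px.
by apply: sub_all (order_path_min e_tr pxs) => a /=; rewrite Px.
Qed.

Lemma cycle_edges_map (G H : sgraph) (f : G -> H) (c : seq G) :
    injective f -> uniq c ->
  cycle_edges (map f c) = [set f @: A | A : {set G} in cycle_edges c].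
Proof.
move=> f_inj uc; apply/setP=> A; apply/imsetP/imsetP.
  case=> _ /mapP[x xs ->] ->; exists [set x; next c x]; first exact: imset_f.
  by rewrite imsetU !imset_set1 next_map.
case=> _ /imsetP[x xs ->] ->.
by exists (f x); rewrite ?map_f // imsetU !imset_set1 next_map.
Qed.

Lemma homo_connect (S T : finType) (e : rel S) (e' : rel T) (f : S -> T) :
    {homo f : x y / e x y >-> e' x y} ->
  {homo f : x y / connect e x y >-> connect e' x y}.
Proof.
move=> fe x y /connectP[p exp ->]; apply/connectP; exists (map f p).
  by rewrite path_map; apply: sub_path exp => a b; apply: fe.
by rewrite last_map.
Qed.

Section Bridge.
Variables (G H : sgraph) (g : G) (h : H).

Definition bridge_adj (x y : G + H) : bool :=
  match x, y with
  | inl x, inl y => adj x y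
  | inr x, inr y => adj x y
  | inl x, inr y | inr y, inl x => (x == g) && (y == h)
  end.

Lemma bridge_adj_sym : symmetric bridge_adj.
Proof. by move=> [x|x] [y|y] //=; apply: adj_sym. Qed.

Lemma bridge_adj_irr : irreflexive bridge_adj.
Proof. by move=> [x|x] /=; apply: adj_irr. Qed.

Definition bridge : sgraph := SGraph bridge_adj_sym bridge_adj_irr.

Lemma bridge_degree (x : bridge) :
  #|[set y | adj x y]| =
  match x with
  | inl x => #|[set y | adj x y]| + (x == g)
  | inr x => #|[set y | adj x y]| + (x == h)
  end.
Proof.
rewrite -sum1dep_card big_mkcond big_sumType -!big_mkcond /=.
case: x => x; rewrite !sum1dep_card; last rewrite [RHS]addnC; congr (_ + _).
  rewrite /=; case: (x == g); last by apply: eq_card0 => y; rewrite !inE.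
  by apply/eqP/cards1P; exists h; apply/setP=> y; rewrite !inE.
rewrite /=; case: (x == h); last by apply: eq_card0 => y; rewrite !inE andbF.
by apply/eqP/cards1P; exists g; apply/setP=> y; rewrite !inE andbT.
Qed.

Lemma bridge_connected : connected G -> connected H -> connected bridge.
Proof.
move=> [G0 Gc] [H0 Hc]; split; first by rewrite card_sum addn_gt0 G0.
have cl x y : connect (@adj bridge) (inl x) (inl y).
  by apply: homo_connect (Gc x y).
have cr x y : connect (@adj bridge) (inr x) (inr y).
  by apply: homo_connect (Hc x y).
have cgh : connect (@adj bridge) (inl g) (inr h).
  by apply: connect1; rewrite /= !eqxx.
have csym : connect_sym (@adj bridge) by apply/sym_connect_sym/adj_sym.
have clr x y : connect (@adj bridge) (inl x) (inr y).
  exact: connect_trans (connect_trans (cl x g) cgh) (cr h y).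
by move=> [x|x] [y|y] //; rewrite csym.
Qed.

(** A cycle meeting both sides would run through the bridge in both directions and so return to [g]
    after two steps. *)
Lemma bridge_cycle (c : seq bridge) : is_cycle c ->
  (exists2 d : seq G, is_cycle d & c = map inl d) \/
  (exists2 d : seq H, is_cycle d & c = map inr d).
Proof.
move=> [sc /andP[cc uc]].
pose left (x : bridge) := if x is inl _ then true else false.
have [all_l|] := boolP (all left c).
  have [d cE] : exists d, c = map inl d.
    elim: c all_l {sc cc uc} => [|[x|x] c IHc] //=; first by exists [::].
    by move=> /IHc[d ->]; exists (x :: d).
  left; exists d => //; split; first by rewrite cE size_map in sc.
  rewrite cE map_inj_uniq in uc; last by move=> ? ? [].
  by rewrite cE cycle_map in cc; apply/andP.
have [all_r _|] := boolP (all (predC left) c).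
  have [d cE] : exists d, c = map inr d.
    elim: c all_r {sc cc uc} => [|[x|x] c IHc] //=; first by exists [::].
    by move=> /IHc[d ->]; exists (x :: d).
  right; exists d => //; split; first by rewrite cE size_map in sc.
  rewrite cE map_inj_uniq in uc; last by move=> ? ? [].
  by rewrite cE cycle_map in cc; apply/andP.
rewrite -!has_predC => /hasP[x xc lx] /hasP[y yc ly].
(* Leaving each side of the bridge needs both of its directed edges. *)
have cross (P : pred bridge) u v : u \in c -> v \in c -> P u -> ~~ P v ->
    exists w, [/\ w \in c, P w & ~~ P (next c w)].
  move=> uc' vc Pu nPv; have [/hasP[w wc /andP[]]|no] :=
    boolP (has (fun w => P w && ~~ P (next c w)) c); first by exists w.
  have /allP/(_ v vc) : all P c; last by rewrite (negPf nPv).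
  apply: next_closed_all uc _ uc' Pu => w wc Pw.
  by move/hasPn: no => /(_ w wc); rewrite /= Pw negbK.
have [[w|w] [wc // _ nw]] := cross left x y xc yc (negbNE lx) ly.
have [[w'|w'] [wc' // _ nw']] := cross (predC left) y x yc xc ly lx.
have := next_cycle cc wc; have := next_cycle cc wc'.
case E: (next c (inl w)) nw => [//|z] _.
case E': (next c (inr w')) nw' => [z'|//] _ /= /andP[/eqP z'E /eqP w'E] /andP[/eqP wE /eqP zE].
by have := next_next_neq uc sc wc; rewrite E zE -w'E E' z'E wE eqxx.
Qed.
End Bridge.

(** * Small graphs given by adjacency tables *)

Section TableGraphs.
(** Adjacency lives on [nat], so that checks over all vertices become closed computations on
    lists. *)
Definition table_rel (t : seq (seq nat)) : rel nat :=
  [rel i j | j \in nth [::] t i].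

Definition symmetric_table n t :=
  all (fun i => all (fun j => table_rel t i j == table_rel t j i) (iota 0 n) &&
                ~~ table_rel t i i) (iota 0 n).

Variables (n : nat) (t : seq (seq nat)).
Hypothesis tP : symmetric_table n t.

Definition table_adj : rel 'I_n := [rel i j : 'I_n | table_rel t i j].

Lemma table_adj_sym : symmetric table_adj.
Proof.
move=> i j; have in_iota (k : 'I_n) : (k : nat) \in iota 0 n by rewrite mem_iota /=.
have /allP/(_ _ (in_iota i))/andP[/allP/(_ _ (in_iota j))/eqP] := tP.
by [].
Qed.

Lemma table_adj_irr : irreflexive table_adj.
Proof.
move=> i; have in_iota (k : 'I_n) : (k : nat) \in iota 0 n by rewrite mem_iota /=.
by have /allP/(_ _ (in_iota i))/andP[_ /negPf] := tP.
Qed.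

Definition table_graph : sgraph := SGraph table_adj_sym table_adj_irr.

Lemma table_degree (i : table_graph) :
  #|[set j | adj i j]| = count (table_rel t i) (iota 0 n).
Proof.
rewrite -sum1dep_card -sum1_count -(big_mkord (table_rel t i) (fun=> 1)).
by rewrite /index_iota subn0.
Qed.

(** Passing repeatedly to a smaller neighbour leads from any vertex to 0. *)
Lemma table_connected :
    0 < n -> all (fun i => has (table_rel t i) (iota 0 i)) (iota 1 n.-1) ->
  connected table_graph.
Proof.
move=> n0 /allP parent; split; first by rewrite card_ord.
have c0 (i : table_graph) : connect (@adj table_graph) i (Ordinal n0).
  case: i => i lti; have [m] := ubnP i; elim: m i lti => // m IHm [|i] lti im.
    by rewrite (_ : Ordinal lti = Ordinal n0) //; apply: val_inj.
  have i_in : i.+1 \in iota 1 n.-1 by rewrite mem_iota /= add1n prednK.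
  have /hasP[j] := parent _ i_in; rewrite mem_iota /= add0n => ji ij; have ltj := ltn_trans ji lti.
  apply: connect_trans (IHm j ltj (leq_trans ji im)).
  exact: connect1.
move=> i j; apply: connect_trans (c0 i) _.
by rewrite (sym_connect_sym (@adj_sym table_graph)).
Qed.

Lemma table_cycle_size (c : seq table_graph) : is_cycle c -> size c <= n.
Proof.
by case=> _ /andP[_ uc]; rewrite -(card_uniqP uc) -[leqRHS]card_ord max_card.
Qed.
End TableGraphs.

Lemma single_tableP : symmetric_table 1 [:: [::]]. Proof. by []. Qed.
Definition single_graph := table_graph single_tableP.

(* K4 with one edge subdivided by the vertex 0. *)
Definition end_table := [:: [:: 1; 2]; [:: 0; 3; 4]; [:: 0; 3; 4]; [:: 1; 2; 4]; [:: 1; 2; 3]].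
Lemma end_tableP : symmetric_table 5 end_table. Proof. by []. Qed.
Definition end_graph := table_graph end_tableP.

(* The 6-cycle 0 1 2 3 4 5 with the two chords 15 and 24. *)
Definition hex_table :=
  [:: [:: 1; 5]; [:: 0; 2; 5]; [:: 1; 3; 4]; [:: 2; 4]; [:: 2; 3; 5]; [:: 0; 1; 4]].
Lemma hex_tableP : symmetric_table 6 hex_table. Proof. by []. Qed.
Definition hex_graph := table_graph hex_tableP.

Lemma single_connected : connected single_graph.
Proof. exact: table_connected. Qed.

Lemma end_connected : connected end_graph.
Proof. exact: table_connected. Qed.

Lemma hex_connected : connected hex_graph.
Proof. exact: table_connected. Qed.

Definition end_root : end_graph := @inord 4 0.
Definition hex_vertex (i : nat) : hex_graph := @inord 5 i.

Lemma end_degree (x : end_graph) : #|[set y | adj x y]| + (x == end_root) = 3.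
Proof.
rewrite table_degree -val_eqE /= inordK //.
by case: x => -[|[|[|[|[|]]]]].
Qed.

Lemma hex_degree (x : hex_graph) :
  #|[set y | adj x y]| + (x == hex_vertex 0) + (x == hex_vertex 3) = 3.
Proof.
rewrite table_degree -!val_eqE /= !inordK //.
by case: x => -[|[|[|[|[|[|]]]]]].
Qed.

(** * Pendant pieces of unbounded order *)

(** The root [r] has degree 2 and awaits a bridge; the bound 5 keeps all cycles shorter than the
    hexagon. *)
Definition pendant (G : sgraph) (r : G) : Prop :=
  [/\ connected G, forall x, #|[set y | adj x y]| + (x == r) = 3 &
      forall c : seq G, is_cycle c -> size c <= 5].

Lemma end_pendant : pendant end_root.
Proof.
split; [exact: end_connected | exact: end_degree | exact: table_cycle_size].
Qed.

(** A new vertex is joined by bridges to an end piece and to [r]; having degree 2, it becomes the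
    next root. *)
Definition add_pendant (G : sgraph) (r : G) : sgraph :=
  @bridge (@bridge single_graph end_graph ord0 end_root) G (inl ord0) r.

Lemma add_pendantP (G : sgraph) (r : G) :
  pendant r -> pendant (inl (inl ord0) : add_pendant r).
Proof.
move=> [Gc Gd Gcyc]; split.
- by do 2?apply: bridge_connected => //; [exact: single_connected | exact: end_connected].
- move=> x; rewrite bridge_degree; case: x => [x|x]; last first.
    by rewrite -[RHS](Gd x) addn0.
  rewrite bridge_degree; case: x => [x|x].
    by rewrite table_degree (ord1 x).
  by rewrite -[RHS](end_degree x) !addn0.
move=> c /bridge_cycle[[d dc ->]|[d /Gcyc dc ->]]; rewrite size_map //.
case/bridge_cycle: dc => -[b bc ->]; rewrite size_map.
  exact: leq_trans (table_cycle_size bc) _.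
exact: table_cycle_size bc.
Qed.

(** The graph is paired with its root, since the recursion attaches the next piece there. *)
Fixpoint pendant_chain (n : nat) : {G : sgraph & G} :=
  if n is n'.+1 then
    existT (fun G : sgraph => G)
      (add_pendant (projT2 (pendant_chain n'))) (inl (inl ord0))
  else existT (fun G : sgraph => G) end_graph end_root.

Lemma pendant_chainP n : pendant (projT2 (pendant_chain n)).
Proof. by elim: n => [|n IHn]; [apply: end_pendant | apply: add_pendantP]. Qed.

Lemma card_pendant_chain n : #|projT1 (pendant_chain n)| = 5 + 6 * n.
Proof.
elim: n => [|n IHn]; first by rewrite card_ord.
by rewrite !card_sum !card_ord IHn mulnS addnCA.
Qed.

(** * The witness graphs and their longest cycle *)

Definition witness_graph (n : nat) : sgraph :=
  @bridge (@bridge end_graph hex_graph end_root (hex_vertex 0))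
    (projT1 (pendant_chain n)) (inr (hex_vertex 3)) (projT2 (pendant_chain n)).

Definition hex_inj n (x : hex_graph) : witness_graph n := inl (inr x).

Lemma hex_inj_inj n : injective (@hex_inj n).
Proof. by move=> x y []. Qed.

Definition hex_cycle : seq hex_graph := map hex_vertex (iota 0 6).

Lemma val_hex_cycle : map val hex_cycle = iota 0 6.
Proof. by rewrite /= !inordK. Qed.

Lemma hex_cycleP : is_cycle hex_cycle.
Proof.
split=> //; rewrite /ucycle -(map_inj_uniq val_inj) val_hex_cycle andbT.
have: cycle (table_rel hex_table) (map val hex_cycle) by rewrite val_hex_cycle.
by rewrite cycle_map.
Qed.

Lemma uniq_hex_cycle : uniq hex_cycle.
Proof. by case: hex_cycleP => _ /andP[]. Qed.

(** The criterion of [in_cycle_edges] over any [eqType], so that it can be evaluated on lists of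
    numbers. *)
Definition cycle_edge_rel (T : eqType) (c : seq T) (x y : T) :=
  (x \in c) && (y == next c x) || (y \in c) && (x == next c y).

Lemma cycle_edge_rel_map (S T : eqType) (f : S -> T) (c : seq S) x y :
    injective f -> uniq c ->
  cycle_edge_rel (map f c) (f x) (f y) = cycle_edge_rel c x y.
Proof.
by move=> f_inj uc; rewrite /cycle_edge_rel !mem_map // !next_map // !(inj_eq f_inj).
Qed.

Fixpoint words (s : seq nat) (k : nat) : seq (seq nat) :=
  if k is k'.+1 then [seq i :: w | i <- s, w <- words s k'] else [:: [::]].

Lemma mem_words s w : {subset w <= s} -> w \in words s (size w).
Proof.
elim: w => [|i w IHw] //= ws; apply: allpairs_f; first exact/ws/mem_head.
by apply: IHw => j jw; apply: ws; rewrite inE jw orbT.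
Qed.

(** Exhaustive check. A Hamiltonian cycle uses both edges at 0 and at 3, which have degree 2; either
    chord would then close a triangle. *)
Lemma hex_words_unique :
  all (fun w => all (fun i => all (fun j =>
      cycle_edge_rel w i j == cycle_edge_rel (iota 0 6) i j) (iota 0 6))
      (iota 0 6))
    [seq w <- words (iota 0 6) 6 | uniq w && cycle (table_rel hex_table) w].
Proof. by vm_compute. Qed.

Lemma hex_cycle_unique (d : seq hex_graph) :
  is_cycle d -> size d = 6 -> cycle_edges d = cycle_edges hex_cycle.
Proof.
move=> [_ /andP[cd ud]] sd.
have in_iota (k : 'I_6) : (k : nat) \in iota 0 6 by rewrite mem_iota /=.
have dW : map val d \in words (iota 0 6) 6.
  have := @mem_words (iota 0 6) (map val d); rewrite size_map sd; apply.
  by move=> _ /mapP[i _ ->]; apply: in_iota.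
have edgeE (x y : hex_graph) :
    ([set x; y] \in cycle_edges d) = ([set x; y] \in cycle_edges hex_cycle).
  rewrite !in_cycle_edges -!/(cycle_edge_rel _ _ _).
  rewrite -(cycle_edge_rel_map x y val_inj ud).
  rewrite -(cycle_edge_rel_map x y val_inj uniq_hex_cycle).
  rewrite val_hex_cycle; apply/eqP.
  have dF : map val d \in
      [seq w <- words (iota 0 6) 6 | uniq w && cycle (table_rel hex_table) w].
    by rewrite mem_filter dW (map_inj_uniq val_inj) ud cycle_map andbT.
  have /allP/(_ _ dF)/allP/(_ _ (in_iota x))/allP := hex_words_unique.
  by move/(_ _ (in_iota y)).
apply/setP=> A; apply/idP/idP=> /imsetP[x xd ->].
  by rewrite -edgeE in_cycle_edges xd eqxx.
by rewrite edgeE in_cycle_edges xd eqxx.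
Qed.

Definition witness_cycle n : seq (witness_graph n) := map (@hex_inj n) hex_cycle.

Lemma witness_cycleP n : is_cycle (witness_cycle n).
Proof.
have [_ /andP[cc uc]] := hex_cycleP.
split=> //; apply/andP; split; first by rewrite cycle_map.
by rewrite (map_inj_uniq (@hex_inj_inj n)).
Qed.

Lemma witness_cycle_cases n (d : seq (witness_graph n)) : is_cycle d ->
  size d <= 5 \/ exists2 b, is_cycle b & d = map (@hex_inj n) b.
Proof.
case/bridge_cycle=> [[b /bridge_cycle[[a ac ->]|[a ac ->]] ->]|[b bc ->]].
- by left; rewrite !size_map table_cycle_size.
- by right; exists a; rewrite -?map_comp.
by left; rewrite size_map; have [_ _] := pendant_chainP n; apply.
Qed.

Lemma witness_unique_longest n : unique_longest_cycle (witness_cycle n).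
Proof.
split; first split; first exact: witness_cycleP.
  move=> d /witness_cycle_cases[/leqW //|[b bc ->]].
  by rewrite size_map; apply: table_cycle_size.
move=> d [dc /(_ _ (witness_cycleP n)) d6]; move: d6.
case/witness_cycle_cases: dc => [d5 d6|[b bc ->]].
  by have := leq_trans d6 d5.
rewrite !size_map => b6; have [_ /andP[_ ub]] := bc.
rewrite !cycle_edges_map ?uniq_hex_cycle //; try exact: hex_inj_inj.
rewrite (hex_cycle_unique bc) //; apply/eqP; rewrite eqn_leq b6 andbT.
exact: table_cycle_size.
Qed.

Lemma witness_connected n : connected (witness_graph n).
Proof.
have [cP _ _] := pendant_chainP n.
apply: bridge_connected => //.
by apply: bridge_connected; [apply: end_connected | apply: hex_connected].
Qed.

Lemma witness_regular n : regular 3 (witness_graph n).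
Proof.
move=> x; rewrite bridge_degree; have [_ dP _] := pendant_chainP n.
case: x => [x|//]; rewrite bridge_degree; case: x => x.
  by rewrite -[RHS](end_degree x) addn0.
by rewrite -[RHS](hex_degree x).
Qed.

(** The first two hypotheses express that [i] and [j] are below 6, where [inord] keeps the index. *)
Lemma witness_chord n i j :
    (hex_vertex i : nat) = i -> (hex_vertex j : nat) = j ->
    table_rel hex_table i j -> ~~ cycle_edge_rel (iota 0 6) i j ->
  @adj (del_edges (cycle_edges (witness_cycle n)))
    (hex_inj n (hex_vertex i)) (hex_inj n (hex_vertex j)).
Proof.
move=> iE jE tij; rewrite -val_hex_cycle -{1}iE -{1}jE => nij; apply/andP; split.
  by move: tij; rewrite -{1}iE -{1}jE.
rewrite in_cycle_edges -/(cycle_edge_rel _ _ _).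
rewrite cycle_edge_rel_map ?uniq_hex_cycle //; last exact: hex_inj_inj.
by rewrite -(cycle_edge_rel_map _ _ val_inj uniq_hex_cycle).
Qed.

Lemma witness_odd_components n : #|odd_components (witness_cycle n)| = 2.
Proof.
apply/eqP; rewrite eqn_leq two_odd_components ?andbT; last exact: witness_unique_longest.
set c := witness_cycle n; pose e := @adj (del_edges (cycle_edges c)).
pose f i := hex_inj n (hex_vertex i).
have e_sym : connect_sym e by apply/sym_connect_sym/adj_sym.
pose comp x := [set y in [set: witness_graph n] | connect e x y].
suff /subset_leq_card/leq_trans : odd_components c \subset [set comp (f 0); comp (f 3)].
  by apply; rewrite cards2 ltnS leq_b1.
apply/subsetP=> K; rewrite inE => /andP[/imsetP[x _ KE] oddK].
have memK y : (y \in K) = connect e x y by rewrite KE !inE.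
have compK y : y \in K -> K = comp y.
  rewrite memK => xy; apply/setP=> z; rewrite memK !inE.
  exact: same_connect.
have f15 : (f 5 \in K) = (f 1 \in K).
  rewrite !memK; apply/esym/(same_connect_r e_sym)/connect1.
  by apply: witness_chord; rewrite ?inordK.
have f24 : (f 4 \in K) = (f 2 \in K).
  rewrite !memK; apply/esym/(same_connect_r e_sym)/connect1.
  by apply: witness_chord; rewrite ?inordK.
have uc : uniq c by case: (witness_cycleP n) => _ /andP[].
have : odd (count [in K] c).
  rewrite -size_filter -(card_uniqP (filter_uniq _ uc)); move: oddK.
  by congr (is_true (odd _)); apply: eq_card => y; rewrite mem_filter inE.
rewrite /= -/(f 0) -/(f 1) -/(f 2) -/(f 3) -/(f 4) -/(f 5) f15 f24 !inE.
case f0K: (f 0 \in K); first by rewrite (compK _ f0K) eqxx.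
case f3K: (f 3 \in K); first by rewrite (compK _ f3K) eqxx orbT.
(* Without [f 0] and [f 3], the vertices of [c] in [K] come in the chord pairs 1, 5 and 2, 4, so
   their number is even. *)
by case: (f 1 \in K) (f 2 \in K) => [] [].
Qed.

Theorem theorem5 :
  (forall (G : sgraph) (c : seq G),
     connected G -> regular 3 G -> unique_longest_cycle c ->
     2 <= #|odd_components c|)
  /\
  (exists F : nat -> sgraph,
     (forall m n : nat, m <> n -> ~ graph_iso (F m) (F n)) /\
     (forall n : nat,
        connected (F n) /\ regular 3 (F n) /\
        exists c : seq (F n),
          unique_longest_cycle c /\ #|odd_components c| = 2)).
Proof.
split=> [G c _ _|]; first exact: two_odd_components.
exists witness_graph; split=> [m n mn [f [f_bij _]]|n].
  (* The graphs are told apart by their orders, [16 + 6 * n]. *)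
  have := bij_eq_card f_bij; rewrite !card_sum !card_pendant_chain.
  by move/addnI/addnI/eqP; rewrite eqn_pmul2l // => /eqP.
split; first exact: witness_connected.
split; first exact: witness_regular.
exists (witness_cycle n); split; first exact: witness_unique_longest.
exact: witness_odd_components.
Qed.
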